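(* Let $p_1=2,p_2,\ldots$ be the consecutive primes, $\chi$ a Dirichlet character, $r\ge1$ an integer and $n\ge1$. Put $\Lambda_r=A_rL(r+1,\chi)L(r+2,\chi)L(r+3,\chi)$ and, for $k\ge1$, \[P_{r,k}=\left(1+\frac{\chi(p_k)}{p_k(p_k^{r+1}-p_k^r-1)}\right)\left(1-\frac{\chi(p_k)}{p_k^{r+2}}\right)\left(1-\frac{\chi(p_k)}{p_k^{r+3}}\right),\qquad E_{r,n}=\prod_{k\ge n+1}P_{r,k}.\] Then \[B_\chi(r)=E_{r,n}\,\Lambda_r\prod_{k=1}^nP_{r,k},\] and, provided that either $r=1$ and $p_{n+1}\ge5$, or $r=2$ and $p_{n+1}\ge3$, \[1-\frac1{p_{n+1}^{r+2}}\le |E_{r,n}|\le 1+\frac1{p_{n+1}^{r+2}}.\]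
   Context: $B_\chi(r)=\prod_p\left(1+\frac{p(\chi(p)-1)}{(p-1)(p^{r+1}-\chi(p))}\right)$ and $A_r=\prod_p\left(1-\frac{1}{p^r(p-1)}\right)$, products over rational primes; $L(s,\chi)=\sum_{n\ge1}\chi(n)n^{-s}=\prod_p(1-\chi(p)p^{-s})^{-1}$ for $\mathrm{Re}(s)>1$. *)

(* Defs.v *)
From Stdlib Require Import Reals.
From Coquelicot Require Import Coquelicot.
From mathcomp Require Import ssreflect ssrfun ssrbool eqtype ssrnat div prime.

Open Scope R_scope.

Definition dirichlet_character (q : nat) (chi : nat -> C) : Prop :=
  (0 < q)%N /\
  chi 1%N = 1%C /\
  (forall m n : nat, chi (m * n)%N = (chi m * chi n)%C) /\
  (forall n : nat, chi (n + q)%N = chi n) /\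
  (forall n : nat, chi n = 0%C <-> gcdn n q <> 1%N).

Lemma exists_prime_above (m : nat) : exists p, (m < p)%N && prime p.
Proof. case: (prime_above m) => p H1 H2. exists p. by rewrite H1 H2. Qed.

Definition next_prime (m : nat) : nat := ex_minn (exists_prime_above m).

(* nth_prime k = p_k, the k-th prime for k >= 1 (p_1 = 2); nth_prime 0 = 0 is a dummy. *)
Fixpoint nth_prime (k : nat) : nat :=
  match k with
  | O => O
  | S j => next_prime (nth_prime j)
  end.

Fixpoint prime_partial_prod (f : nat -> C) (N : nat) : C :=
  match N with
  | O => 1%C
  | S m => (prime_partial_prod f m * (if prime m then f m else 1%C))%C
  end.

Fixpoint prime_partial_prodR (f : nat -> R) (N : nat) : R :=
  match N with
  | O => 1
  | S m => prime_partial_prodR f m * (if prime m then f m else 1)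
  end.

Definition is_prime_prod (f : nat -> C) (l : C) : Prop :=
  filterlim (prime_partial_prod f) eventually (locally l).

Definition is_prime_prodR (f : nat -> R) (l : R) : Prop :=
  filterlim (prime_partial_prodR f) eventually (locally l).

(* Finite product  prod_{k = a}^{b} u k  (empty, i.e. 1, if b < a). *)
Fixpoint prod_range (u : nat -> C) (a : nat) (len : nat) : C :=
  match len with
  | O => 1%C
  | S m => (prod_range u a m * u (a + m)%N)%C
  end.

Definition prod_from_to (u : nat -> C) (a b : nat) : C :=
  prod_range u a (b + 1 - a).

Definition is_tail_prod (u : nat -> C) (a : nat) (l : C) : Prop :=
  filterlim (fun N => prod_from_to u a N) eventually (locally l).

Definition npowC (p e : nat) : C := RtoC (INR p ^ e).

Definition B_factor (chi : nat -> C) (r : nat) (p : nat) : C :=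
  (1 + (INR p * (chi p - 1)) / ((INR p - 1) * (npowC p (r + 1) - chi p)))%C.

Definition A_factor (r : nat) (p : nat) : R :=
  1 - 1 / (INR p ^ r * (INR p - 1)).

Definition is_L_value (chi : nat -> C) (s : nat) (l : C) : Prop :=
  is_series (fun n : nat => (chi (S n) / npowC (S n) s)%C) l.

Definition P_factor (chi : nat -> C) (r : nat) (k : nat) : C :=
  let p := nth_prime k in
  ((1 + chi p / (INR p * (INR p ^ (r + 1) - INR p ^ r - 1)))
   * (1 - chi p / npowC p (r + 2))
   * (1 - chi p / npowC p (r + 3)))%C.

(* Main.v *)
Require Import Defs.
From Stdlib Require Import Reals Lra.
From Coquelicot Require Import Coquelicot.
From mathcomp Require Import ssreflect ssrfun ssrbool eqtype ssrnat div prime.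
From mathcomp Require Import zify.

Open Scope R_scope.

(* Write f(n) = chi(n) / n^s.  Summing f only over the integers with no prime factor
   below N gives L(s, chi) prod_(p < N) (1 - f(p)), since each prime p sieves out f(p)
   times the current sum; these sums tend to f(1) = 1, which is the Euler product
   without any inverse.  The identity for B_chi(r) is then an identity between the
   factors at each prime.  For the tail, |P_(r,k) - 1| is at most 4 / p^5 (r = 1) or
   3 / p^6 (r = 2) with p = p_k; this is small against p^-(r+2) - (p+1)^-(r+2), so the
   quantities |P_(r,k)| (1 +- p_(k+1)^-(r+2)) compare with 1 +- p_k^-(r+2) and the
   bounds telescope. *)

(** * Limits of complex sequences *)

(** Convergence in C is encoded by the real sequence of distances, so that squeeze and comparison
    arguments for real limits apply directly. *)
Definition clim (u : nat -> C) (l : C) : Prop :=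
  is_lim_seq (fun n => Cmod (u n - l)%C) 0.

Lemma climP (u : nat -> C) (l : C) :
  clim u l <-> filterlim u eventually (@locally C_UniformSpace l).
Proof.
(* The balls of the uniform structure on C are products of real balls; they are traded here for
   balls of the modulus. *)
have E : filterlim u eventually (@locally C_UniformSpace l) <->
    forall eps : posreal, eventually (fun n => Cmod (u n - l)%C < eps).
  exact: (@filterlim_locally_ball_norm C_AbsRing nat C_NormedModule
            eventually _ u l).
rewrite E /clim -is_lim_seq_spec /=.
have absE n : Rabs (Cmod (u n - l)%C - 0) = Cmod (u n - l)%C.
  by rewrite Rminus_0_r Rabs_pos_eq //; apply: Cmod_ge_0.
by split=> H eps; have [N HN] := H eps; exists N => n /HN; rewrite absE.
Qed.

Lemma clim_le (u : nat -> C) (l : C) (b : nat -> R) :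
  (forall n, Cmod (u n - l)%C <= b n) -> is_lim_seq b 0 -> clim u l.
Proof.
move=> ub b0; apply: (is_lim_seq_le_le (fun=> 0) _ b) => //; last exact: is_lim_seq_const.
by move=> n; split; [apply: Cmod_ge_0 | apply: ub].
Qed.

Lemma clim_const (l : C) : clim (fun=> l) l.
Proof.
apply: (clim_le _ _ (fun=> 0)); last exact: is_lim_seq_const.
by move=> n; rewrite (_ : (l - l)%C = 0%C) ?Cmod_0; [lra | ring].
Qed.

Lemma clim_ext (u v : nat -> C) (l : C) :
  (forall n, u n = v n) -> clim u l -> clim v l.
Proof. by move=> uv; apply: is_lim_seq_ext => n; rewrite uv. Qed.

Lemma clim_ext_loc (u v : nat -> C) (l : C) :
  eventually (fun n => u n = v n) -> clim u l -> clim v l.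
Proof.
move=> [N uv]; apply: is_lim_seq_ext_loc; exists N => n Nn.
by rewrite uv.
Qed.

Lemma clim_subseq (u : nat -> C) (l : C) (phi : nat -> nat) :
  filterlim phi eventually eventually -> clim u l -> clim (fun n => u (phi n)) l.
Proof. exact: is_lim_seq_subseq. Qed.

Lemma clim_unique (u : nat -> C) (l m : C) : clim u l -> clim u m -> l = m.
Proof.
move=> /climP ul /climP um.
exact: (@filterlim_locally_unique nat C_AbsRing C_NormedModule eventually
          _ u l m).
Qed.

Lemma clim_mult (u v : nat -> C) (l m : C) :
  clim u l -> clim v m -> clim (fun n => (u n * v n)%C) (l * m)%C.
Proof.
move=> ul vm.
pose a n := Cmod (u n - l)%C; pose b n := Cmod (v n - m)%C.
apply: (clim_le _ _ (fun n => a n * b n + (a n * Cmod m + Cmod l * b n))).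
  move=> n; rewrite /a /b -!Cmod_mult.
  rewrite (_ : (u n * v n - l * m = (u n - l) * (v n - m) +
    ((u n - l) * m + l * (v n - m)))%C); last by ring.
  apply: Rle_trans (Cmod_triangle _ _) _.
  by have := Cmod_triangle ((u n - l) * m)%C (l * (v n - m))%C; lra.
rewrite [X in is_lim_seq _ (Finite X)](_ : 0 = 0 * 0 + (0 * Cmod m + Cmod l * 0)); last by ring.
apply: is_lim_seq_plus'; first exact: is_lim_seq_mult'.
apply: is_lim_seq_plus'; apply: is_lim_seq_mult' => //; exact: is_lim_seq_const.
Qed.

Lemma clim_opp (u : nat -> C) (l : C) : clim u l -> clim (fun n => (- u n)%C) (- l)%C.
Proof.
move=> ul; apply: (clim_ext (fun n => (- (1) * u n)%C)); first by move=> n; ring.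
rewrite (_ : (- l = - (1) * l)%C); last by ring.
by apply: clim_mult => //; apply: clim_const.
Qed.

Lemma clim_plus (u v : nat -> C) (l m : C) :
  clim u l -> clim v m -> clim (fun n => (u n + v n)%C) (l + m)%C.
Proof.
move=> ul vm.
apply: (clim_le _ _ (fun n => Cmod (u n - l)%C + Cmod (v n - m)%C)).
  move=> n; rewrite (_ : (u n + v n - (l + m) = (u n - l) + (v n - m))%C); last by ring.
  exact: Cmod_triangle.
by rewrite [X in is_lim_seq _ (Finite X)](_ : 0 = 0 + 0); [apply: is_lim_seq_plus' | ring].
Qed.

Lemma clim1_ge_half (u : nat -> C) :
  clim u 1%C -> eventually (fun n => / 2 <= Cmod (u n)).
Proof.
move=> /is_lim_seq_spec /(_ (mkposreal (/ 2) ltac:(lra))) /= [N HN].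
exists N => n /HN; rewrite Rminus_0_r Rabs_pos_eq => [un|]; last exact: Cmod_ge_0.
have := Cmod_triangle (u n) (- (u n - 1))%C.
rewrite Cmod_opp (_ : (u n + - (u n - 1) = 1)%C) ?Cmod_1; last by ring.
by lra.
Qed.

Lemma clim_inv1 (u : nat -> C) : clim u 1%C -> clim (fun n => (/ u n)%C) 1%C.
Proof.
move=> u1; have [N HN] := clim1_ge_half u u1.
apply: (is_lim_seq_le_le_loc (fun=> 0) _ (fun n => 2 * Cmod (u n - 1)%C)).
- exists N => n /HN un; split; first exact: Cmod_ge_0.
  have un0 : u n <> 0%C by apply/Cmod_gt_0; lra.
  rewrite (_ : (/ u n - 1 = - (u n - 1) / u n)%C); last by field.
  rewrite Cmod_div // Cmod_opp /Rdiv Rmult_comm.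
  apply: Rmult_le_compat_r; first exact: Cmod_ge_0.
  rewrite -[X in _ <= X]Rinv_inv; apply: Rinv_le_contravar; lra.
- exact: is_lim_seq_const.
- rewrite [X in is_lim_seq _ (Finite X)](_ : 0 = 2 * 0); last by ring.
  by apply: is_lim_seq_mult' => //; apply: is_lim_seq_const.
Qed.

(** A factor tending to 1 can be divided out because its inverse also tends to 1. This lets Euler
    products be used in the form product times L-value tends to 1. *)
Lemma clim_cancel1 (u v : nat -> C) (l : C) :
  clim v 1%C -> clim (fun n => (u n * v n)%C) l -> clim u l.
Proof.
move=> v1 uv; have [N HN] := clim1_ge_half v v1.
rewrite -(Cmult_1_r l); apply: clim_ext_loc (clim_mult _ _ _ _ uv (clim_inv1 _ v1)).
exists N => n /HN vn; field; apply/Cmod_gt_0; lra.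
Qed.

Lemma clim_RtoC (u : nat -> R) (l : R) :
  is_lim_seq u l -> clim (fun n => RtoC (u n)) (RtoC l).
Proof.
move=> ul; apply: (clim_le _ _ (fun n => Rabs (u n - l))).
  by move=> n; rewrite -RtoC_minus Cmod_R; apply: Rle_refl.
apply/(is_lim_seq_abs_0 (fun n => u n - l)).
rewrite (_ : 0 = l - l); last by ring.
by apply: is_lim_seq_minus' => //; apply: is_lim_seq_const.
Qed.

Lemma clim_Cmod (u : nat -> C) (l : C) :
  clim u l -> is_lim_seq (fun n => Cmod (u n)) (Cmod l).
Proof.
move=> ul.
apply: (is_lim_seq_le_le (fun n => Cmod l - Cmod (u n - l)%C) _
                         (fun n => Cmod l + Cmod (u n - l)%C)).
- move=> n; split.
    have := Cmod_triangle (u n) (- (u n - l))%C.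
    rewrite Cmod_opp (_ : (u n + - (u n - l) = l)%C); last by ring.
    by lra.
  have := Cmod_triangle l (u n - l)%C.
  by rewrite (_ : (l + (u n - l) = u n)%C) //; ring.
- rewrite -[X in is_lim_seq _ (Finite X)]Rminus_0_r.
  by apply: is_lim_seq_minus' => //; apply: is_lim_seq_const.
- rewrite -[X in is_lim_seq _ (Finite X)]Rplus_0_r.
  by apply: is_lim_seq_plus' => //; apply: is_lim_seq_const.
Qed.

(** * Partial sums and convergent series *)

Fixpoint csum (a : nat -> C) (N : nat) : C :=
  if N is m.+1 then (csum a m + a m)%C else 0%C.

(** [csum a N] stops before index N, while [sum_n a N] includes it; hence the shift. *)
Lemma csum_sum_n (a : nat -> C) N : csum a N.+1 = sum_n (G := C_AbelianMonoid) a N.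
Proof.
elim: N => [|N IH]; first by rewrite sum_O /= Cplus_0_l.
by rewrite sum_Sn -IH.
Qed.

Lemma clim_shift (u : nat -> C) (l : C) : clim (fun n => u n.+1) l <-> clim u l.
Proof. by split=> H; apply/(is_lim_seq_incr_1 (fun n => Cmod (u n - l)%C)). Qed.

Lemma is_series_csum (a : nat -> C) (l : C) :
  @is_series C_AbsRing C_NormedModule a l <-> clim (csum a) l.
Proof.
rewrite -clim_shift /is_series.
split.
  move=> /climP H; apply: clim_ext H => n; exact: esym (csum_sum_n a n).
move=> H; apply/climP; apply: clim_ext H => n; exact: csum_sum_n a n.
Qed.

Fixpoint rsum (a : nat -> R) (N : nat) : R :=
  if N is m.+1 then rsum a m + a m else 0.

Lemma rsum_sum_n (a : nat -> R) N : rsum a N.+1 = sum_n a N.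
Proof.
elim: N => [|N IH]; first by rewrite sum_O /= Rplus_0_l.
by rewrite sum_Sn -IH.
Qed.

Lemma ex_series_bounded (b : nat -> R) (M : R) :
  (forall n, 0 <= b n) -> (forall N, rsum b N <= M) -> ex_series b.
Proof.
move=> b0 bM.
have [l Hl] : ex_finite_lim_seq (sum_n b).
  apply: (ex_finite_lim_seq_incr _ M) => n.
    by rewrite sum_Sn /plus /=; have := b0 n.+1; lra.
  by rewrite -rsum_sum_n.
by exists l.
Qed.

Lemma csum_cvg_le (a : nat -> C) (b : nat -> R) :
  (forall n, Cmod (a n) <= b n) -> ex_series b -> exists l, clim (csum a) l.
Proof.
move=> ab exb.
have [l Hl] := @ex_series_le C_AbsRing C_CompleteNormedModule a b ab exb.
by exists l; apply/is_series_csum.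
Qed.

(** * Infinite products *)

Lemma INR_S_gt0 n : 0 < INR n.+1.
Proof. exact: lt_0_INR (Nat.lt_0_succ n). Qed.

(** The induction needs the sharper bound 2 - 1/M, which telescopes through 1/(x+1)^2 <= 1/x -
    1/(x+1). *)
Lemma rsum_inv_sqr_le N : rsum (fun k => / INR k.+1 ^ 2) N <= 2.
Proof.
pose f k := / INR k.+1 ^ 2.
have H M : rsum f M.+1 <= 2 - / INR M.+1.
  elim: M => [|M IH]; first by rewrite /f /=; lra.
  change (rsum f M.+1 + f M.+1 <= 2 - / INR M.+2).
  apply: Rle_trans (Rplus_le_compat_r _ _ _ IH) _.
  rewrite /f (S_INR M.+1); have := INR_S_gt0 M; move: (INR M.+1) => x x0.
  have H : / (x + 1) ^ 2 <= / x - / (x + 1).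
    rewrite (_ : / x - / (x + 1) = / (x * (x + 1))); last by field; lra.
    by apply: Rinv_le_contravar; nra.
  by lra.
case: N => [|N]; first by rewrite /=; lra.
apply: Rle_trans (H N) _.
by have := Rinv_0_lt_compat _ (INR_S_gt0 N); lra.
Qed.

Lemma inv_sqr_ge0 c k : 0 <= c -> 0 <= c * / INR k.+1 ^ 2.
Proof.
move=> c0; apply: Rmult_le_pos => //; apply/Rlt_le/Rinv_0_lt_compat/pow_lt.
exact: INR_S_gt0.
Qed.

Lemma rsumS b N : rsum b N.+1 = rsum b N + b N.
Proof. by []. Qed.

Lemma rsum_scal c b N : rsum (fun k => c * b k) N = c * rsum b N.
Proof. by elim: N => [|N /= ->]; rewrite /=; ring. Qed.

Lemma ex_series_inv_sqr c : 0 <= c -> ex_series (fun k => c * / INR k.+1 ^ 2).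
Proof.
move=> c0; apply: (ex_series_bounded _ (c * 2)) => N; first exact: inv_sqr_ge0.
rewrite rsum_scal; apply: Rmult_le_compat_l => //; exact: rsum_inv_sqr_le.
Qed.

(** By 1 + x <= exp x the partial products stay bounded by exp(2c). Their increments, a partial
    product times the next [u - 1], are then dominated by a convergent series, and the partial
    products are 1 plus the sums of these increments. *)
Lemma prod_range_cvg (u : nat -> C) (a : nat) (c : R) :
  0 <= c -> (forall m, Cmod (u (a + m)%N - 1)%C <= c * / INR m.+1 ^ 2) ->
  exists l, clim (prod_range u a) l.
Proof.
move=> c0 uc.
have bd N : Cmod (prod_range u a N) <= exp (rsum (fun k => c * / INR k.+1 ^ 2) N).
  elim: N => [|N IH]; first by rewrite /= Cmod_1 exp_0; apply: Rle_refl.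
  rewrite [prod_range _ _ _]/= Cmod_mult rsumS exp_plus.
  apply: Rmult_le_compat => //; try exact: Cmod_ge_0.
  apply: Rle_trans (exp_ineq1_le _).
  have := Cmod_triangle 1%C (u (a + N)%N - 1)%C; rewrite Cmod_1.
  rewrite (_ : (1 + (u (a + N)%N - 1) = u (a + N)%N)%C); last by ring.
  by have := uc N; lra.
have bd2 N : Cmod (prod_range u a N) <= exp (c * 2).
  apply: Rle_trans (bd N) _; rewrite rsum_scal.
  have [lt|->] := Rmult_le_compat_l _ _ _ c0 (rsum_inv_sqr_le N); last exact: Rle_refl.
  exact: Rlt_le (exp_increasing _ _ lt).
have ec0 : 0 <= exp (c * 2) * c by apply: Rmult_le_pos => //; apply/Rlt_le/exp_pos.
have [N|l Hl] := csum_cvg_le (fun N => prod_range u a N * (u (a + N)%N - 1))%C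
  (fun N => (exp (c * 2) * c) * / INR N.+1 ^ 2) _ (ex_series_inv_sqr _ ec0).
  rewrite Cmod_mult Rmult_assoc.
  apply: Rmult_le_compat => //; exact: Cmod_ge_0.
exists (1 + l)%C.
apply: clim_ext (clim_plus _ _ _ _ (clim_const 1%C) Hl) => N /=.
elim: N => [|N /= <-]; first by rewrite /=; ring.
by rewrite /=; ring.
Qed.

Lemma prod_range_cat (u : nat -> C) a k l :
  prod_range u a (k + l) = (prod_range u a k * prod_range u (a + k) l)%C.
Proof.
elim: l => [|l IH]; first by rewrite addn0 /=; ring.
by rewrite addnS /= IH addnA; ring.
Qed.

Lemma filterlim_eventually (phi : nat -> nat) :
  (forall K, exists N, forall n, (N <= n)%N -> (K <= phi n)%N) ->
  filterlim phi eventually eventually.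
Proof.
move=> H P [K HK]; have [N HN] := H K; exists N => n /leP Nn.
by apply: HK; apply/leP; apply: HN.
Qed.

(** * Products over primes *)

Fixpoint prime_count (N : nat) : nat :=
  if N is m.+1 then (prime_count m + prime m)%N else 0%N.

Lemma next_primeP m :
  [/\ (m < next_prime m)%N, prime (next_prime m) &
      forall p, (m < p)%N -> prime p -> (next_prime m <= p)%N].
Proof.
rewrite /next_prime; case: ex_minnP => p /andP[mp pp] H; split=> // q mq qp.
by apply: H; rewrite mq.
Qed.

Lemma prime_nth_prime k : prime (nth_prime k.+1).
Proof. by case: (next_primeP (nth_prime k)). Qed.

Lemma nth_prime_ltS k : (nth_prime k < nth_prime k.+1)%N.
Proof. by case: (next_primeP (nth_prime k)). Qed.

Lemma nth_prime_mono k l : (k <= l)%N -> (nth_prime k <= nth_prime l)%N.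
Proof.
move=> /subnK <-; elim: (l - k)%N => [|d IH] //.
by apply: leq_trans IH _; rewrite addSn; apply/ltnW/nth_prime_ltS.
Qed.

Lemma leq_nth_prime k : (k <= nth_prime k)%N.
Proof. by elim: k => // k IH; apply: leq_ltn_trans IH (nth_prime_ltS k). Qed.

(** Passing to N+1, either N+1 is prime, and minimality of the next prime makes it p_(k+1), or it
    differs from p_(k+1) and stays below it. The start N = 0 relies on the dummy value p_0 = 0. *)
Lemma prime_count_bounds N :
  (nth_prime (prime_count N.+1) <= N < nth_prime (prime_count N.+1).+1)%N.
Proof.
elim: N => [|N].
  by case: (next_primeP 0) => H _ _; rewrite /= H.
rewrite [prime_count N.+2]/= -/(prime_count N.+1); set k := prime_count N.+1.
have [H1 H2 H3] := next_primeP (nth_prime k).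
case pN: (prime N.+1) => /andP[kN Nk]; last first.
  rewrite addn0 (leq_trans kN) //= ltn_neqAle Nk andbT.
  by apply: contraFN pN => /eqP ->.
have E : nth_prime k.+1 = N.+1.
  by apply/eqP; rewrite eqn_leq Nk andbT; apply: H3.
by rewrite addn1 E leqnn -E; apply: nth_prime_ltS.
Qed.

(** This links the two ways of indexing: [B_factor] is multiplied over primes below a cut-off,
    [P_factor] along the enumeration p_1, p_2, ... *)
Lemma prime_partial_prod_nth (f : nat -> C) N :
  prime_partial_prod f N = prod_range (fun k => f (nth_prime k)) 1 (prime_count N).
Proof.
elim: N => // N IH; rewrite /= IH; case pN: (prime N); last by rewrite addn0; ring.
rewrite addn1 /=; congr (_ * f _)%C.
case: N pN {IH} => // N pN.
have /andP[kN Nk] := prime_count_bounds N.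
have [H1 H2 H3] := next_primeP (nth_prime (prime_count N.+1)).
by apply/eqP; rewrite eqn_leq Nk; apply: H3.
Qed.

Lemma prime_count_lim : filterlim prime_count eventually eventually.
Proof.
apply: filterlim_eventually => K; exists (nth_prime K).+1 => -[|n] // Kn.
have /andP[_ H] := prime_count_bounds n.
rewrite leqNgt; apply/negP => lt_K.
by have := nth_prime_mono _ _ lt_K; lia.
Qed.

(** * The Euler product of a completely multiplicative function *)

Lemma csum_cat (a : nat -> C) N M :
  csum a (N + M) = (csum a N + csum (fun i => a (N + i)%N) M)%C.
Proof.
elim: M => [|M IH]; first by rewrite addn0 /=; ring.
by rewrite addnS /= IH; ring.
Qed.

Lemma csum_eq0 (a : nat -> C) N :
  (forall i, (i < N)%N -> a i = 0%C) -> csum a N = 0%C.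
Proof.
elim: N => // N IH a0 /=; rewrite a0 // IH; first by ring.
by move=> i iN; apply: a0; rewrite ltnS ltnW.
Qed.

Lemma csum_ext (a b : nat -> C) N : (forall i, a i = b i) -> csum a N = csum b N.
Proof. by move=> ab; elim: N => //= N ->; rewrite ab. Qed.

Lemma csum_plus (a b : nat -> C) N :
  csum (fun i => a i + b i)%C N = (csum a N + csum b N)%C.
Proof. by elim: N => [|N /= ->] /=; ring. Qed.

Lemma csum_scal (c : C) (a : nat -> C) N :
  csum (fun i => c * a i)%C N = (c * csum a N)%C.
Proof. by elim: N => [|N /= ->] /=; ring. Qed.

(** The range splits into blocks of p consecutive integers, and only the last integer of each block
    is a multiple of p. *)
Lemma csum_multiples (g : nat -> C) p K : (0 < p)%N ->
  csum (fun n => if (p %| n.+1)%N then g n.+1 else 0%C) (p * K) =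
  csum (fun m => g (p * m.+1)%N) K.
Proof.
case: p => // p _; elim: K => [|K IH]; first by rewrite muln0.
rewrite mulnS addnC csum_cat IH [csum _ p.+1]/= (csum_eq0 _ p); last first.
  move=> i ip; rewrite -addnS dvdn_addr ?dvdn_mulr //.
  by rewrite gtnNdvd.
rewrite -addnS -mulnSr dvdn_mulr // [csum _ K.+1]/=; ring.
Qed.

(** These are the N-rough numbers. The recursion follows that of [prime_partial_prod], so that each
    factor of the product matches one sieving step. *)
Fixpoint rough (N n : nat) : bool :=
  if N is m.+1 then rough m n && (prime m ==> ~~ (m %| n)%N) else true.

Lemma roughP N n :
  reflect (forall p, prime p -> (p < N)%N -> ~~ (p %| n)%N) (rough N n).
Proof.
elim: N => [|N IH] /=; first by apply: ReflectT.
apply: (iffP andP) => [[/IH H /implyP HN] p pp|H].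
  by rewrite ltnS leq_eqVlt => /orP[/eqP E|]; [rewrite E in pp *; apply: HN | apply: H].
split; first by apply/IH => p pp pN; apply: H => //; rewrite ltnS ltnW.
by apply/implyP => pN; apply: H.
Qed.

Lemma rough1 N : rough N 1.
Proof. by apply/roughP => p pp _; rewrite dvdn1; apply: contraL pp => /eqP ->. Qed.

Lemma rough_small N n : (1 < n < N)%N -> rough N n = false.
Proof.
case/andP => n1 nN; apply/negP => /roughP /(_ (pdiv n) (pdiv_prime n1)).
rewrite pdiv_dvd /= => H.
have : (pdiv n < N)%N by apply: leq_ltn_trans nN; apply: pdiv_leq; apply: ltnW.
by move/H.
Qed.

(** A prime q < p differs from p, so it divides p n exactly when it divides n. *)
Lemma rough_mul_prime p n : prime p -> rough p (p * n) = rough p n.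
Proof.
move=> pp; apply/roughP/roughP => H q qp lt_qp; move: (H q qp lt_qp); last first.
  rewrite Euclid_dvdM // negb_or => ->; rewrite andbT.
  by rewrite dvdn_prime2 //; apply: contraTN lt_qp => /eqP ->; rewrite ltnn.
by apply: contra => qn; apply: dvdn_mull.
Qed.

Section Euler.

Variables (f : nat -> C) (L : C).
Hypothesis f1 : f 1%N = 1%C.
(** Only positive arguments occur, because [f] will be chi(n)/n^s, which at 0 divides by zero. *)
Hypothesis fM : forall m n, f (m.+1 * n.+1)%N = (f m.+1 * f n.+1)%C.
Hypothesis f_le : forall n, Cmod (f n.+1) <= / INR n.+1 ^ 2.
Hypothesis fL : clim (csum (fun n => f n.+1)) L.

Let g N n := if rough N n then f n else 0%C.

Let g_le N n : Cmod (g N n.+1) <= 1 * / INR n.+1 ^ 2.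
Proof.
rewrite /g; case: ifP => _; first by rewrite Rmult_1_l; apply: f_le.
by rewrite Cmod_0; apply: inv_sqr_ge0; lra.
Qed.

(** When N is prime, passing from N-rough to (N+1)-rough integers discards the N m with m itself
    N-rough. These contribute f(N) times the current sum S, leaving (1 - f(N)) S. *)
Lemma rough_series N :
  clim (csum (fun n => g N n.+1)) (prime_partial_prod (fun p => 1 - f p)%C N * L)%C.
Proof.
elim: N => [|N IH]; first by rewrite /= Cmult_1_l.
rewrite [prime_partial_prod _ _]/=; case pN: (prime N); last first.
  rewrite Cmult_1_r; apply: clim_ext IH => K; apply: csum_ext => i.
  by rewrite /g /= pN andbT.
set S := (_ * L)%C in IH.
pose h n := if (N %| n)%N then g N n else 0%C.
(* The sum over multiples of N first gets some limit by domination; its value can then be read off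
   along a subsequence. *)
have [n|l hl] := csum_cvg_le (fun n => h n.+1) (fun n => 1 * / INR n.+1 ^ 2) _
    (ex_series_inv_sqr 1 Rle_0_1).
  rewrite /h; case: ifP => _; first exact: g_le.
  by rewrite Cmod_0; apply: inv_sqr_ge0; lra.
have lE : l = (f N * S)%C.
  (* The cut-offs N K end on complete blocks, where [csum_multiples] applies. *)
  apply: (clim_unique (fun K => csum (fun n => h n.+1) (N * K)%N)).
    apply: (clim_subseq (csum (fun n => h n.+1))) hl.
    apply: filterlim_eventually => K; exists K => n Kn.
    by apply: leq_trans Kn _; apply: leq_pmull; apply: prime_gt0.
  apply: clim_ext (clim_mult _ _ _ _ (clim_const (f N)) IH) => K.
  rewrite csum_multiples ?prime_gt0 // -csum_scal; apply: csum_ext => i.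
  rewrite /g rough_mul_prime //; case: ifP => _; last by ring.
  by rewrite -(prednK (prime_gt0 pN)) fM.
have := clim_plus _ _ _ _ IH (clim_opp _ _ hl).
rewrite lE (_ : (S + - (f N * S) =
  prime_partial_prod (fun p => 1 - f p) N * (1 - f N) * L)%C); last by rewrite /S; ring.
move=> H; apply: clim_ext H => K.
rewrite (_ : (- csum (fun n => h n.+1) K = csum (fun n => - (1) * h n.+1) K)%C); last by rewrite csum_scal; ring.
rewrite -csum_plus; apply: csum_ext => i.
rewrite /h /g /= pN; case: (rough N i.+1); case: (N %| i.+1)%N => /=; ring.
Qed.

(** The only N-rough integer in [1, N-1] is 1, so the sum over N-rough integers differs from f(1) =
    1 by at most the tail of the series of 1/n^2 from n = N on. *)
Lemma Euler_product :
  clim (fun N => prime_partial_prod (fun p => 1 - f p)%C N * L)%C 1%C.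
Proof.
pose b n := 1 * / INR n.+1 ^ 2.
have [Lb HLb] := ex_series_inv_sqr 1 Rle_0_1.
have limb : is_lim_seq (fun N => rsum b N.+1) Lb.
  apply: (is_lim_seq_ext (sum_n b)) => [N|]; last exact: HLb.
  by rewrite rsum_sum_n.
have leb N : rsum b N.+1 <= Lb.
  apply: (is_lim_seq_incr_compare _ _ limb) => n.
  by rewrite (rsumS _ n.+1); have := inv_sqr_ge0 1 n.+1 Rle_0_1; rewrite /b; lra.
(* Shifting twice makes N = K+2, so the first K+1 terms are exactly the integers below N and include
   1. *)
apply/clim_shift/clim_shift.
apply: (clim_le _ _ (fun K => Lb - rsum b K.+1)); last first.
  rewrite (_ : 0 = Lb - Lb); last by ring.
  by apply: is_lim_seq_minus' => //; apply: is_lim_seq_const.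
move=> K; set N := K.+2; set S := (_ * L)%C.
have gK : csum (fun n => g N n.+1) K.+1 = 1%C.
  rewrite -add1n csum_cat (csum_eq0 _ K) ?Cplus_0_r /=; last first.
    move=> i iK; rewrite /g rough_small //; by rewrite /N; lia.
  by rewrite /g rough1 f1; ring.
have bd j : Cmod (csum (fun n => g N n.+1) (j + K.+1) - 1)%C <=
            rsum b (j + K.+1) - rsum b K.+1.
  elim: j => [|j IH].
    rewrite add0n gK (_ : (1 - 1)%C = 0%C) ?Cmod_0; [lra | ring].
  rewrite addSn rsumS [csum _ _.+1]/=; set x := csum _ _ in IH *.
  rewrite (_ : (_ - 1 = (x - 1) + g N (j + K.+1).+1)%C); last by ring.
  apply: Rle_trans (Cmod_triangle _ _) _.
  by have := g_le N (j + K.+1)%N; rewrite -/(b _); lra.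
have lim1 : clim (fun j => csum (fun n => g N n.+1) (j + K.+1) - 1)%C (S - 1)%C.
  apply: clim_plus; last exact: clim_const.
  apply: clim_subseq (rough_series N).
  by apply: filterlim_eventually => M; exists M => n; lia.
(* The bound is uniform in the number j of further terms, so it passes to the limit as j grows. *)
apply: (is_lim_seq_le _ (fun=> Lb - rsum b K.+1) (Cmod (S - 1)%C) (Lb - rsum b K.+1)
         _ (clim_Cmod _ _ lim1)); last exact: is_lim_seq_const.
by move=> j; apply: Rle_trans (bd j) _; rewrite addnS; have := leb (j + K)%N; lra.
Qed.

End Euler.

(** * Dirichlet characters *)

Lemma rsum_ge_term (b : nat -> R) N i :
  (forall k, 0 <= b k) -> (i < N)%N -> b i <= rsum b N.
Proof.
move=> b0; have s0 M : 0 <= rsum b M.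
  by elim: M => [|M IH] /=; [lra | have := b0 M; lra].
elim: N => // N IH; rewrite ltnS leq_eqVlt rsumS => /orP[/eqP ->|/IH].
  by have := s0 N; lra.
by have := b0 N; lra.
Qed.

(* A character is bounded by periodicity, and a bounded multiplicative function
   is bounded by 1, as seen by evaluating it at powers. *)
Lemma dirichlet_character_le1 q chi n :
  dirichlet_character q chi -> Cmod (chi n) <= 1.
Proof.
case=> q0 [chi1 [chiM [chiD _]]].
pose M := rsum (fun k => Cmod (chi k)) q.
have chi_le m : Cmod (chi m) <= M.
  have -> : chi m = chi (m %% q)%N.
    rewrite {1}(divn_eq m q); elim: (m %/ q)%N => [|k IH] //.
    by rewrite mulSn -addnA addnC chiD.
  apply: (rsum_ge_term (fun k => Cmod (chi k))); last by rewrite ltn_pmod.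
  by move=> k; apply: Cmod_ge_0.
have chiX k : Cmod (chi (n ^ k)%N) = Cmod (chi n) ^ k.
  elim: k => [|k IH]; first by rewrite expn0 chi1 Cmod_1.
  by rewrite expnS chiM Cmod_mult IH.
apply: Rnot_lt_le => gt1.
pose x := Cmod (chi n) - 1; have x0 : 0 < x by rewrite /x; lra.
(* With k x > M, Bernoulli's inequality [poly] makes the k-th power of 1 + x exceed the bound M. *)
have [k Hk] := INR_unbounded (M / x).
have := poly k x x0; rewrite (_ : 1 + x = Cmod (chi n)); last by rewrite /x; ring.
rewrite -chiX; have := chi_le (n ^ k)%N.
have : M < INR k * x.
  by apply: (Rmult_lt_reg_r (/ x)); [apply: Rinv_0_lt_compat | field_simplify; lra].
by lra.
Qed.

Lemma prime_INR_ge2 p : prime p -> 2 <= INR p.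
Proof. by move=> /prime_gt1 /leP /le_INR. Qed.

Definition L_term (chi : nat -> C) (s n : nat) : C := (chi n / npowC n s)%C.

Section LFunction.

Variables (q : nat) (chi : nat -> C).
Hypothesis chiP : dirichlet_character q chi.

Lemma L_term_mul s m n :
  L_term chi s (m.+1 * n.+1) = (L_term chi s m.+1 * L_term chi s n.+1)%C.
Proof.
have [_ [_ [chiM _]]] := chiP.
have nz k : RtoC (INR k.+1 ^ s) <> 0%C.
  by move/RtoC_inj; apply: Rgt_not_eq; apply: pow_lt; apply: INR_S_gt0.
rewrite /L_term /npowC chiM mulnE mult_INR Rpow_mult_distr RtoC_mult.
by field; split; apply: nz.
Qed.

Lemma L_term_le s n : (2 <= s)%N -> Cmod (L_term chi s n.+1) <= / INR n.+1 ^ 2.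
Proof.
move=> s2; have x1 : 1 <= INR n.+1 by apply: (le_INR 1); lia.
have xs : 0 < INR n.+1 ^ s by apply: pow_lt; lra.
rewrite /L_term /npowC Cmod_div; last by move/RtoC_inj; lra.
rewrite Cmod_R Rabs_pos_eq; last lra.
rewrite /Rdiv -[X in _ <= X]Rmult_1_l; apply: Rmult_le_compat.
- exact: Cmod_ge_0.
- exact/Rlt_le/Rinv_0_lt_compat.
- exact: dirichlet_character_le1 chiP.
apply: Rinv_le_contravar; first by apply: pow_lt; lra.
by apply: Rle_pow => //; apply/leP.
Qed.

Lemma L_value_Euler s : (2 <= s)%N ->
  exists L, is_L_value chi s L /\
    clim (fun N => prime_partial_prod (fun p => 1 - L_term chi s p)%C N * L)%C 1%C.
Proof.
move=> s2.
have [n|L HL] := csum_cvg_le (fun n => L_term chi s n.+1)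
    (fun n => 1 * / INR n.+1 ^ 2) _ (ex_series_inv_sqr 1 Rle_0_1).
  by rewrite Rmult_1_l; apply: L_term_le.
exists L; split; first exact/is_series_csum.
have [_ [chi1 _]] := chiP.
apply: Euler_product HL => [||n]; [|exact: L_term_mul|exact: L_term_le].
by rewrite /L_term /npowC chi1 pow1; field.
Qed.

End LFunction.

(** * The local factors *)

(** Here w stands for chi(p), and x, y, z for the reciprocals of p(p^(r+1) - p^r - 1), p^(r+2),
    p^(r+3). *)
Definition P_local (x y z : R) (w : C) : C :=
  ((1 + w * RtoC x) * (1 - w * RtoC y) * (1 - w * RtoC z))%C.

(** The three terms are the absolute values of the coefficients of w, w^2, w^3 in the expansion. *)
Lemma P_local_sub1_le x y z w : Cmod w <= 1 ->
  Cmod (P_local x y z w - 1)%C <=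
  Rabs (x - y - z) + Rabs (y * z - x * (y + z)) + Rabs (x * y * z).
Proof.
move=> w1.
have -> : (P_local x y z w - 1 = w * RtoC (x - y - z) +
   w * w * RtoC (y * z - x * (y + z)) + w * w * w * RtoC (x * y * z))%C.
  rewrite /P_local !(RtoC_minus, RtoC_mult, RtoC_plus); ring.
have w0 := Cmod_ge_0 w.
have ww : Cmod w * Cmod w <= 1 by nra.
have www : Cmod w * Cmod w * Cmod w <= 1 by nra.
apply: Rle_trans (Cmod_triangle _ _) _; apply: Rplus_le_compat.
  apply: Rle_trans (Cmod_triangle _ _) _; rewrite !Cmod_mult !Cmod_R.
  apply: Rplus_le_compat; rewrite -[X in _ <= X]Rmult_1_l;
    apply: Rmult_le_compat_r => //; exact: Rabs_pos.
rewrite !Cmod_mult Cmod_R -[X in _ <= X]Rmult_1_l.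
apply: Rmult_le_compat_r => //; exact: Rabs_pos.
Qed.

(** This is [P_factor] indexed by the prime instead of its rank; the two agree by conversion at
    [nth_prime k]. *)
Definition P_at (chi : nat -> C) (r p : nat) : C :=
  ((1 + chi p / (INR p * (INR p ^ (r + 1) - INR p ^ r - 1)))
   * (1 - chi p / npowC p (r + 2))
   * (1 - chi p / npowC p (r + 3)))%C.

(** The difference of the two sides is (t^2 - t)(t^(r-1) - 1). The lower bound is at least 1 for t
    >= 2, so the denominator stays positive even at p = 2. *)
Lemma P_denom_ge (t : R) r : 2 <= t -> (1 <= r)%N ->
  t * t - t - 1 <= t ^ (r + 1) - t ^ r - 1.
Proof.
move=> t2; case: r => // r _.
have r1 : 1 <= t ^ r by apply: pow_R1_Rle; lra.
have := Rmult_le_pos (t * t - t) (t ^ r - 1) ltac:(nra) ltac:(lra).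
by rewrite addn1 /=; nra.
Qed.

Lemma P_atE chi r p : (1 <= r)%N -> prime p ->
  P_at chi r p = P_local (/ (INR p * (INR p ^ (r + 1) - INR p ^ r - 1)))
    (/ INR p ^ (r + 2)) (/ INR p ^ (r + 3)) (chi p).
Proof.
move=> r1 /prime_INR_ge2; rewrite /P_at /P_local /npowC; move: (INR p) => t t2.
have D := P_denom_ge t r t2 r1.
rewrite -!RtoC_pow -!RtoC_minus -RtoC_mult /Cdiv -!RtoC_inv //;
  try (by apply: Rgt_not_eq; apply: pow_lt; lra).
nra.
Qed.

(** A crude bound for all r and p, meant for convergence. With u = 1/p^2 one has x <= 2u and y, z <=
    u, so the three coefficients are at most 4u, 5u^2 and 2u^3, and 4 + 5 + 2 = 11. *)
Lemma P_at_sub1_le q chi r p : dirichlet_character q chi -> (1 <= r)%N -> prime p ->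
  Cmod (P_at chi r p - 1)%C <= 11 * / INR p ^ 2.
Proof.
move=> chiP r1 pp; rewrite P_atE //.
apply: Rle_trans (P_local_sub1_le _ _ _ _ (dirichlet_character_le1 _ _ _ chiP)) _.
move: (prime_INR_ge2 _ pp); move: (INR p) => t t2.
have D := P_denom_ge t r t2 r1.
have t2p : 0 < t ^ 2 by apply: pow_lt; lra.
set u := / t ^ 2.
have u0 : 0 < u by apply: Rinv_0_lt_compat.
have u1 : u <= 1 by rewrite /u -Rinv_1; apply: Rinv_le_contravar; nra.
have pw k : (2 <= k)%N -> 0 < / t ^ k <= u.
  move=> k2; split; first by apply: Rinv_0_lt_compat; apply: pow_lt; lra.
  by apply: Rinv_le_contravar => //; apply: Rle_pow; [lra | apply/leP].
have [y0 yu] := pw (r + 2)%N ltac:(lia); have [z0 zu] := pw (r + 3)%N ltac:(lia).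
set d := t * _.
have dt : t ^ 2 * / 2 <= d by rewrite /d /=; nra.
have xu : / d <= 2 * u.
  rewrite -[2]Rinv_inv /u -Rinv_mult Rmult_comm; apply: Rinv_le_contravar => //; lra.
have x0 : 0 < / d by apply: Rinv_0_lt_compat; lra.
move: (/ d) (/ t ^ (r + 2)) (/ t ^ (r + 3)) x0 xu y0 yu z0 zu => x y z x0 xu y0 yu z0 zu.
have a1 : Rabs (x - y - z) <= x + y + z by apply: Rabs_le; lra.
have xy : 0 <= x * (y + z) <= 2 * u * (2 * u).
  by split; [nra | apply: Rmult_le_compat; lra].
have yz : 0 <= y * z <= u * u by split; [nra | apply: Rmult_le_compat; lra].
have a2 : Rabs (y * z - x * (y + z)) <= 5 * (u * u) by apply: Rabs_le; lra.
have a3 : Rabs (x * y * z) <= 2 * u * (u * u).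
  by rewrite Rmult_assoc Rabs_pos_eq; [apply: Rmult_le_compat; lra | nra].
have uu : u * u <= u by nra.
have uuu : u * (u * u) <= u by nra.
lra.
Qed.

(** The leading parts of x and y cancel. Everything is bounded by x - y - z + x(y+z), and the
    constant 4 then amounts to 2t^2 - 6t - 5 >= 0, true for t >= 5 but false at t = 3. *)
Lemma P_at_sub1_le_r1 q chi p : dirichlet_character q chi -> prime p -> (5 <= p)%N ->
  Cmod (P_at chi 1 p - 1)%C <= 4 * / INR p ^ 5.
Proof.
move=> chiP pp /leP /le_INR; rewrite P_atE //.
move=> p5; apply: Rle_trans (P_local_sub1_le _ _ _ _ (dirichlet_character_le1 _ _ _ chiP)) _.
move: p5; rewrite (INR_IZR_INZ 5) (_ : (1 + 1 = 2)%N) // (_ : (1 + 2 = 3)%N) // (_ : (1 + 3 = 4)%N) //.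
move: (INR p) => t /= t5.
have D1 : 1 <= t * t - t - 1 by nra.
have D : 0 < t * t - t - 1 by lra.
have t0 k : 0 < t ^ k by apply: pow_lt; lra.
set x := / (t * _); set y := / (t * (t * (t * 1))); set z := / (t * (t * (t * (t * 1)))).
have yE : y = / t ^ 3 by []; have zE : z = / t ^ 4 by [].
have xE : x = / (t * (t * t - t - 1)) by rewrite /x; congr (/ _); ring.
have y0 : 0 < y by rewrite yE; apply: Rinv_0_lt_compat.
have z0 : 0 < z by rewrite zE; apply: Rinv_0_lt_compat.
have xyz : x - y - z = (2 * t + 1) * / (t ^ 4 * (t * t - t - 1)).
  by rewrite xE yE zE; field; split; lra.
have xyz0 : 0 <= x - y - z.
  rewrite xyz; apply: Rmult_le_pos; first lra.
  by apply/Rlt_le/Rinv_0_lt_compat; apply: Rmult_lt_0_compat.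
have x1 : x <= 1 by rewrite xE -[X in _ <= X]Rinv_1; apply: Rinv_le_contravar; [lra|nra].
have s : x - y - z + x * (y + z) = (2 * t * t + 2 * t + 1) * / (t ^ 5 * (t * t - t - 1)).
  by rewrite xE yE zE; field; split; lra.
have s4 : x - y - z + x * (y + z) <= 4 * / t ^ 5.
  rewrite s Rinv_mult.
  apply: (Rmult_le_reg_r (t ^ 5 * (t * t - t - 1))); first exact: Rmult_lt_0_compat.
  by field_simplify; [nra | lra | split; lra].
(* As x >= y + z, the quadratic coefficient is nonpositive, with absolute value x(y+z) - yz; the
   cubic term xyz <= yz is absorbed by -yz. *)
rewrite (Rabs_pos_eq (x - y - z)) // Rabs_left1; last by nra.
rewrite Rabs_pos_eq; last by apply: Rmult_le_pos; nra.
have yz0 : 0 < y * z by apply: Rmult_lt_0_compat.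
have : x * y * z <= y * z by rewrite Rmult_assoc; move: (y * z) yz0 => v v0; nra.
rewrite /= in s4.
lra.
Qed.

(** Same scheme as for r = 1; the constant 3 amounts to 2t^3 - 4t^2 - 2t - 4 >= 0, true from t = 3
    on. *)
Lemma P_at_sub1_le_r2 q chi p : dirichlet_character q chi -> prime p -> (3 <= p)%N ->
  Cmod (P_at chi 2 p - 1)%C <= 3 * / INR p ^ 6.
Proof.
move=> chiP pp /leP /le_INR; rewrite P_atE //.
move=> p3; apply: Rle_trans (P_local_sub1_le _ _ _ _ (dirichlet_character_le1 _ _ _ chiP)) _.
move: p3; rewrite (INR_IZR_INZ 3) (_ : (2 + 1 = 3)%N) // (_ : (2 + 2 = 4)%N) // (_ : (2 + 3 = 5)%N) //.
move: (INR p) => t /= t3.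
have D1 : 1 <= t * t * t - t * t - 1 by nra.
have D : 0 < t * t * t - t * t - 1 by lra.
have t0 k : 0 < t ^ k by apply: pow_lt; lra.
set x := / (t * (_ - _)); set y := / (t * (t * (t * (t * 1)))).
set z := / (t * (t * (t * (t * (t * 1))))).
have yE : y = / t ^ 4 by []; have zE : z = / t ^ 5 by [].
have xE : x = / (t * (t * t * t - t * t - 1)) by rewrite /x; congr (/ _); ring.
have y0 : 0 < y by rewrite yE; apply: Rinv_0_lt_compat.
have z0 : 0 < z by rewrite zE; apply: Rinv_0_lt_compat.
have xyz : x - y - z = (t * t + t + 1) * / (t ^ 5 * (t * t * t - t * t - 1)).
  by rewrite xE yE zE; field; split; lra.
have xyz0 : 0 <= x - y - z.
  rewrite xyz; apply: Rmult_le_pos; first nra.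
  by apply/Rlt_le/Rinv_0_lt_compat; apply: Rmult_lt_0_compat.
have x1 : x <= 1 by rewrite xE -[X in _ <= X]Rinv_1; apply: Rinv_le_contravar; [lra|nra].
have s : x - y - z + x * (y + z) =
    (t * t * t + t * t + 2 * t + 1) * / (t ^ 6 * (t * t * t - t * t - 1)).
  by rewrite xE yE zE; field; split; lra.
have s3 : x - y - z + x * (y + z) <= 3 * / t ^ 6.
  rewrite s Rinv_mult.
  apply: (Rmult_le_reg_r (t ^ 6 * (t * t * t - t * t - 1))); first exact: Rmult_lt_0_compat.
  by field_simplify; [nra | lra | split; lra].
rewrite (Rabs_pos_eq (x - y - z)) // Rabs_left1; last by nra.
rewrite Rabs_pos_eq; last by apply: Rmult_le_pos; nra.
have yz0 : 0 < y * z by apply: Rmult_lt_0_compat.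
have : x * y * z <= y * z by rewrite Rmult_assoc; move: (y * z) yz0 => v v0; nra.
rewrite /= in s3.
lra.
Qed.

Lemma A_factor_bounds r p : (1 <= r)%N -> prime p -> 0 <= A_factor r p <= 1.
Proof.
move=> r1 /prime_INR_ge2; rewrite /A_factor; move: (INR p) => t t2.
have tr : 1 <= t ^ r by apply: pow_R1_Rle; lra.
have d1 : 1 <= t ^ r * (t - 1) by nra.
have d2 : / (t ^ r * (t - 1)) <= 1 by rewrite -[X in _ <= X]Rinv_1; apply: Rinv_le_contravar; lra.
have d3 : 0 < / (t ^ r * (t - 1)) by apply: Rinv_0_lt_compat; lra.
by rewrite /Rdiv Rmult_1_l; lra.
Qed.

(** All factors lie in [0, 1], so the partial products decrease and are bounded below. *)
Lemma A_prod_cvg r : (1 <= r)%N -> exists A, is_prime_prodR (A_factor r) A.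
Proof.
move=> r1.
have fb m : 0 <= (if prime m then A_factor r m else 1) <= 1.
  by case: ifP => [pm|_]; [apply: A_factor_bounds | lra].
have A0 N : 0 <= prime_partial_prodR (A_factor r) N.
  by elim: N => [|N IH] /=; [lra | apply: Rmult_le_pos => //; case: (fb N)].
have [|A HA] := ex_finite_lim_seq_decr (prime_partial_prodR (A_factor r)) 0 _ A0.
  by move=> N /=; have := A0 N; have := fb N; nra.
by exists A.
Qed.

(** The factors at r+2 and r+3 occur on both sides. With X = p^r, what remains equals (p(pX - X - 1)
    + chi(p)) / (pX(p-1)) on each side. *)
Lemma B_factor_local q chi r p :
  dirichlet_character q chi -> (1 <= r)%N -> prime p ->
  (B_factor chi r p * ((1 - L_term chi (r + 1) p) * (1 - L_term chi (r + 2) p) *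
     (1 - L_term chi (r + 3) p)) = RtoC (A_factor r p) * P_at chi r p)%C.
Proof.
move=> chiP r1 /prime_INR_ge2 t2.
have w1 := dirichlet_character_le1 _ _ p chiP.
rewrite /B_factor /L_term /A_factor /P_at /npowC.
move: (INR p) (chi p) t2 w1 => t w t2 w1.
have D := P_denom_ge t r t2 r1; rewrite addn1 /= in D.
rewrite addn1 addn2 addn3 /= -RtoC_pow.
have tr : 1 <= t ^ r by apply: pow_R1_Rle; lra.
move: (t ^ r) tr D => X X1 D.
have t0 : RtoC t <> 0%C by move/RtoC_inj; lra.
have t1 : (t - 1)%C <> 0%C by rewrite -RtoC_minus => /RtoC_inj; lra.
have X0 : RtoC X <> 0%C by move/RtoC_inj; lra.
have D0 : (t * X - X - 1)%C <> 0%C.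
  by rewrite -RtoC_mult -!RtoC_minus => /RtoC_inj; nra.
(* The denominator of [B_factor] cannot vanish, since |chi(p)| <= 1 < p^(r+1). *)
have w0 : (t * X - w)%C <> 0%C.
  rewrite -RtoC_mult => E; have Ew : w = RtoC (t * X).
    by rewrite -[w]Cplus_0_r -E; ring.
  by move: w1; rewrite Ew Cmod_R Rabs_pos_eq; nra.
rewrite RtoC_minus RtoC_div; last by apply: Rmult_integral_contrapositive_currified; lra.
rewrite !RtoC_mult RtoC_minus.
by field; do !split.
Qed.

Lemma prime_partial_prod_mul (f g : nat -> C) N :
  (prime_partial_prod f N * prime_partial_prod g N)%C =
  prime_partial_prod (fun p => f p * g p)%C N.
Proof. by elim: N => [|N /= <-] /=; [ring | case: (prime N); ring]. Qed.

Lemma eq_prime_partial_prod (f g : nat -> C) N :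
  (forall p, prime p -> f p = g p) -> prime_partial_prod f N = prime_partial_prod g N.
Proof. by move=> fg; elim: N => //= N ->; case: ifP => // /fg ->. Qed.

Lemma prime_partial_prod_RtoC (f : nat -> R) N :
  prime_partial_prod (fun p => RtoC (f p)) N = RtoC (prime_partial_prodR f N).
Proof. by elim: N => //= N ->; rewrite RtoC_mult; case: ifP. Qed.

(** * Bounds for the tail product *)

(** The induction carries the weights 1 + h and 1 - h at the current end of the product; they are
    dropped at the close because h >= 0. *)
Lemma prod_range_Cmod_bounds (u : nat -> C) (h : nat -> R) a :
  (forall k, (a <= k)%N -> 0 <= h k) ->
  (forall k, (a <= k)%N ->
     Cmod (u k) * (1 + h k.+1) <= 1 + h k /\ 1 - h k <= Cmod (u k) * (1 - h k.+1)) ->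
  forall j, 1 - h a <= Cmod (prod_range u a j) <= 1 + h a.
Proof.
move=> h0 H j; pose c := Cmod (prod_range u a j).
have c0 : 0 <= c by apply: Cmod_ge_0.
suff [H1 H2] : c * (1 + h (a + j)%N) <= 1 + h a /\ 1 - h a <= c * (1 - h (a + j)%N).
  have := h0 (a + j)%N (leq_addr _ _); rewrite -/c; nra.
rewrite /c {c c0}; elim: j => [|j [IH1 IH2]].
  by rewrite addn0 /= Cmod_1; lra.
have [H1 H2] := H (a + j)%N (leq_addr _ _).
rewrite addnS /= Cmod_mult.
have c0 := Cmod_ge_0 (prod_range u a j).
have := Rmult_le_compat_l _ _ _ c0 H1; have := Rmult_le_compat_l _ _ _ c0 H2.
lra.
Qed.

(** From 1 - d <= |z| <= 1 + d, the one condition (1 + d)(1 + e) <= 1 + h gives the upper estimate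
    and also d + e <= h, hence the lower one. *)
Lemma Cmod_near1_bounds (z : C) (d e e' h : R) :
  Cmod (z - 1)%C <= d -> 0 <= e' <= e -> e <= 1 -> d * (1 + e) + e <= h ->
  Cmod z * (1 + e') <= 1 + h /\ 1 - h <= Cmod z * (1 - e').
Proof.
move=> zd e'e e1 dh.
have d0 := Cmod_ge_0 (z - 1)%C.
have up : Cmod z <= 1 + d.
  have := Cmod_triangle 1%C (z - 1)%C; rewrite Cmod_1.
  by rewrite (_ : (1 + (z - 1) = z)%C); [lra | ring].
have low : 1 - d <= Cmod z.
  have := Cmod_triangle z (- (z - 1))%C; rewrite Cmod_opp.
  by rewrite (_ : (z + - (z - 1) = 1)%C) ?Cmod_1; [lra | ring].
have := Cmod_ge_0 z; move: (Cmod z) up low => c up low c0.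
by split; nra.
Qed.

Lemma telescope_r1 (t : R) : 5 <= t ->
  4 * / t ^ 5 * (1 + / (t + 1) ^ 3) + / (t + 1) ^ 3 <= / t ^ 3.
Proof.
move=> t5; apply/Rminus_le_0.
have -> : / t ^ 3 - (4 * / t ^ 5 * (1 + / (t + 1) ^ 3) + / (t + 1) ^ 3) =
  (3 * t ^ 4 - t ^ 3 - 11 * t ^ 2 - 12 * t - 8) * / (t ^ 5 * (t + 1) ^ 3).
  by field; lra.
apply: Rmult_le_pos; last first.
  by apply/Rlt_le/Rinv_0_lt_compat; apply: Rmult_lt_0_compat; apply: pow_lt; lra.
(* In u = t - 5 the quartic has only positive coefficients. *)
have -> : t = (t - 5) + 5 by ring.
have : 0 <= t - 5 by lra.
move: (t - 5) => u u0; have u2 : 0 <= u ^ 2 by apply: pow_le.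
have u3 : 0 <= u ^ 3 by apply: pow_le.
have u4 : 0 <= u ^ 4 by apply: pow_le.
nra.
Qed.

Lemma telescope_r2 (t : R) : 3 <= t ->
  3 * / t ^ 6 * (1 + / (t + 1) ^ 4) + / (t + 1) ^ 4 <= / t ^ 4.
Proof.
move=> t3; apply/Rminus_le_0.
have -> : / t ^ 4 - (3 * / t ^ 6 * (1 + / (t + 1) ^ 4) + / (t + 1) ^ 4) =
  (4 * t ^ 5 + 3 * t ^ 4 - 8 * t ^ 3 - 17 * t ^ 2 - 12 * t - 6) * / (t ^ 6 * (t + 1) ^ 4).
  by field; lra.
apply: Rmult_le_pos; last first.
  by apply/Rlt_le/Rinv_0_lt_compat; apply: Rmult_lt_0_compat; apply: pow_lt; lra.
(* In u = t - 3 the quintic has only positive coefficients. *)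
have -> : t = (t - 3) + 3 by ring.
have : 0 <= t - 3 by lra.
move: (t - 3) => u u0; have u2 : 0 <= u ^ 2 by apply: pow_le.
have u3 : 0 <= u ^ 3 by apply: pow_le.
have u4 : 0 <= u ^ 4 by apply: pow_le.
have u5 : 0 <= u ^ 5 by apply: pow_le.
nra.
Qed.

(** The next prime is at least p + 1, which replaces p_(k+2) by p_(k+1) + 1 and leaves an inequality
    in one real variable. *)
Lemma P_factor_telescope q chi r k :
  dirichlet_character q chi ->
  (r = 1%N /\ (5 <= nth_prime k.+1)%N) \/ (r = 2%N /\ (3 <= nth_prime k.+1)%N) ->
  let h k := / INR (nth_prime k) ^ (r + 2) in
  Cmod (P_factor chi r k.+1) * (1 + h k.+2) <= 1 + h k.+1 /\
  1 - h k.+1 <= Cmod (P_factor chi r k.+1) * (1 - h k.+2).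
Proof.
move=> chiP Hr h.
have pp := prime_nth_prime k.
have t2 := prime_INR_ge2 _ pp.
have t't : INR (nth_prime k.+1) + 1 <= INR (nth_prime k.+2).
  by rewrite -S_INR; apply/le_INR/leP/nth_prime_ltS.
have e1 : / (INR (nth_prime k.+1) + 1) ^ (r + 2) <= 1.
  by rewrite -[X in _ <= X]Rinv_1; apply: Rinv_le_contravar; [lra | apply: pow_R1_Rle; lra].
have e2 : 0 <= h k.+2 <= / (INR (nth_prime k.+1) + 1) ^ (r + 2).
  split; first by apply/Rlt_le/Rinv_0_lt_compat; apply: pow_lt; lra.
  apply: Rinv_le_contravar; first by apply: pow_lt; lra.
  by apply: pow_incr; lra.
case: Hr => -[rE p_ge]; subst r.
- apply: Cmod_near1_bounds e2 e1 _; first exact: P_at_sub1_le_r1 chiP pp p_ge.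
  by apply: telescope_r1; move/leP/le_INR: p_ge; rewrite (INR_IZR_INZ 5).
- apply: Cmod_near1_bounds e2 e1 _; first exact: P_at_sub1_le_r2 chiP pp p_ge.
  by apply: telescope_r2; move/leP/le_INR: p_ge; rewrite (INR_IZR_INZ 3).
Qed.

Lemma tail_index_lim a : filterlim (fun N => N + 1 - a)%N eventually eventually.
Proof. by apply: filterlim_eventually => K; exists (K + a)%N => n; lia. Qed.

(** * The product identity and the bounds on the tail *)

Theorem theorem5p1 (q : nat) (chi : nat -> C) (r n : nat) :
  dirichlet_character q chi -> (1 <= r)%N -> (1 <= n)%N ->
  exists (B : C) (A : R) (L1 L2 L3 : C) (E : C),
    is_prime_prod (B_factor chi r) B /\
    is_prime_prodR (A_factor r) A /\
    is_L_value chi (r + 1) L1 /\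
    is_L_value chi (r + 2) L2 /\
    is_L_value chi (r + 3) L3 /\
    is_tail_prod (P_factor chi r) (n + 1) E /\
    B = (E * (RtoC A * L1 * L2 * L3) * prod_from_to (P_factor chi r) 1 n)%C /\
    (((r = 1%N /\ (5 <= nth_prime (n + 1))%N) \/
      (r = 2%N /\ (3 <= nth_prime (n + 1))%N)) ->
     1 - 1 / INR (nth_prime (n + 1)) ^ (r + 2) <= Cmod E /\
     Cmod E <= 1 + 1 / INR (nth_prime (n + 1)) ^ (r + 2)).
Proof.
move=> chiP r1 n1.
have [A HA] := A_prod_cvg r r1.
have [L1 [HL1 E1]] := L_value_Euler q chi chiP (r + 1) ltac:(lia).
have [L2 [HL2 E2]] := L_value_Euler q chi chiP (r + 2) ltac:(lia).
have [L3 [HL3 E3]] := L_value_Euler q chi chiP (r + 3) ltac:(lia).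
have [|m|E HE] := prod_range_cvg (P_factor chi r) (n + 1) 11; first lra.
  have pp : prime (nth_prime (n + 1 + m)) by rewrite addn1 addSn; apply: prime_nth_prime.
  apply: Rle_trans (P_at_sub1_le q chi r _ chiP r1 pp) _.
  apply: Rmult_le_compat_l; first lra.
  apply: Rinv_le_contravar; first exact: pow_lt (INR_S_gt0 m).
  apply: pow_incr; split; first exact: Rlt_le (INR_S_gt0 m).
  apply/le_INR/leP/(leq_trans _ (leq_nth_prime _)); lia.
pose P0 := prod_from_to (P_factor chi r) 1 n.
have Pn k : (n <= k)%N ->
    prod_range (P_factor chi r) 1 k = (P0 * prod_range (P_factor chi r) (n + 1) (k - n))%C.
  move=> nk; rewrite /P0 /prod_from_to addnK -[in LHS](subnKC nk) prod_range_cat.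
  by rewrite addnC.
have HP : clim (prod_range (P_factor chi r) 1) (P0 * E)%C.
  have sub : filterlim (fun k => k - n)%N eventually eventually.
    by apply: filterlim_eventually => K; exists (K + n)%N => k; lia.
  apply: clim_ext_loc (clim_mult _ _ _ _ (clim_const P0) (clim_subseq _ _ _ sub HE)).
  by exists n => k /leP nk; rewrite Pn.
have HPp : clim (prime_partial_prod (P_at chi r)) (P0 * E)%C.
  apply: clim_ext (clim_subseq _ _ _ prime_count_lim HP) => N.
  by rewrite prime_partial_prod_nth.
(* The witness for B is the claimed right-hand side, so what remains is that the product of
   [B_factor] converges to it. *)
exists (E * (RtoC A * L1 * L2 * L3) * P0)%C, A, L1, L2, L3, E.
have HT : clim (fun N => prod_from_to (P_factor chi r) (n + 1) N) E.
  exact: clim_subseq _ _ _ (tail_index_lim (n + 1)) HE.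
do 7?[split=> //]; first last.
- move=> Hr.
  pose h k := / INR (nth_prime k) ^ (r + 2).
  have bd N : 1 - h (n + 1)%N <= Cmod (prod_range (P_factor chi r) (n + 1) N) <= 1 + h (n + 1)%N.
    (* Indices start at n + 1, so the dummy p_0 = 0 never enters [h]. *)
    apply: (prod_range_Cmod_bounds _ h) => -[|k] nk; try by exfalso; lia.
      apply/Rlt_le/Rinv_0_lt_compat/pow_lt.
      by have := prime_INR_ge2 _ (prime_nth_prime k); lra.
    apply: (P_factor_telescope q) => //.
    by have := nth_prime_mono _ _ nk; case: Hr => -[-> H] H'; [left | right]; split=> //; lia.
  have lim := clim_Cmod _ _ HE.
  rewrite /Rdiv Rmult_1_l -/(h _); split.
    apply: (is_lim_seq_le (fun=> 1 - h (n + 1)%N) _ (1 - h (n + 1)%N) (Cmod E) _ _ lim) => [N|].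
      by case: (bd N).
    exact: is_lim_seq_const.
  apply: (is_lim_seq_le _ (fun=> 1 + h (n + 1)%N) (Cmod E) (1 + h (n + 1)%N) _ lim) => [N|].
    by case: (bd N).
  exact: is_lim_seq_const.
- exact/climP.
apply/climP.
have S1 := clim_mult _ _ _ _ (clim_mult _ _ _ _ E1 E2) E3.
rewrite !Cmult_1_l in S1.
(* The B-product is multiplied by the three Euler expressions, whose product tends to 1; the local
   identity then turns it into the products of [A_factor] and [P_at] times L1 L2 L3. *)
apply: (clim_cancel1 _ _ _ S1).
apply: (clim_ext (fun N => RtoC (prime_partial_prodR (A_factor r) N) *
  prime_partial_prod (P_at chi r) N * (L1 * L2 * L3))%C).
  move=> N; rewrite -prime_partial_prod_RtoC prime_partial_prod_mul.
  rewrite -(eq_prime_partial_prod _ _ N (fun p pp => B_factor_local q chi r p chiP r1 pp)).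
  by rewrite -!prime_partial_prod_mul; ring.
rewrite (_ : (E * _ * P0 = RtoC A * (P0 * E) * (L1 * L2 * L3))%C); last by ring.
apply: clim_mult (clim_const _); apply: clim_mult HPp.
exact: clim_RtoC.
Qed.
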